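(* Let $F(x)=f(x)+\delta_{\mathcal M}(x)$ on $\mathbb{R}^n$ and $\widetilde F(x,u)=\Psi^*(-u)+\langle u,|Y^Tx|\rangle+\delta_{\mathcal M}(x)$ on $\mathbb{R}^n\times\mathbb{R}^p$. Suppose that $\phi$ is strictly concave and $\phi_+':\mathbb{R}_+\to\mathbb{R}_+$ is locally Lipschitz continuous. If $F$ satisfies the KL property at $\bar x\in\mathcal M$ with exponent $\alpha\in[\frac12,1)$, then $(\bar x,-\nabla\Psi(|Y^T\bar x|))\in\mathrm{dom}\,\partial\widetilde F$ and $\widetilde F$ satisfies the KL property at $(\bar x,-\nabla\Psi(|Y^T\bar x|))$ with exponent $\alpha$.
   Context: Setting. $Y\in\mathbb{R}^{n\times p}$; $\phi:\mathbb{R}_+\to\mathbb{R}_+$ is a continuous concave function with $\phi(0)=0$, differentiable on $(0,\infty)$, such that the limit $\ell:=\lim_{s\downarrow0}\phi'(s)$ exists (in $\mathbb{R}$). $\phi_+'(s)=\lim_{h\downarrow0}\frac{\phi(s+h)-\phi(s)}{h}$ is the right derivative. $|y|$ is the vector of entrywise absolute values. $f(x)=\sum_{i=1}^p\phi(|[Y^Tx]_i|)$, $\mathcal M=\{u\in\mathbb{R}^n:\|u\|=1\}$ (Euclidean norm), $\delta_{\mathcal M}$ is the indicator function of $\mathcal M$ ($0$ on $\mathcal M$, $+\infty$ elsewhere). The function $\Psi$. $\psi:\mathbb{R}\to\mathbb{R}$ is the convex function $\psi(s)=-\phi(s)$ for $s\ge0$ and $\psi(s)=s^2-\ell s$ for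 $s<0$; $\Psi(y)=\sum_{i=1}^p\psi(y_i)$ (a differentiable convex function), and $\Psi^*(w)=\sum_{i=1}^p\psi^*(w_i)$ with $\psi^*(w)=\sup_s\{ws-\psi(s)\}$ the Fenchel conjugate. Subdifferentials. For a proper closed $h:\mathbb{R}^m\to(-\infty,\infty]$ and $\bar x\in\mathrm{dom}\,h$, the regular subdifferential is $\widehat\partial h(\bar x)=\{v:\liminf_{x\to\bar x,x\ne\bar x}\frac{h(x)-h(\bar x)-\langle v,x-\bar x\rangle}{\|x-\bar x\|}\ge0\}$ and the limiting subdifferential is $\partial h(\bar x)=\{v:\exists x^k\to\bar x,\ h(x^k)\to h(\bar x),\ v^k\in\widehat\partial h(x^k),\ v^k\to v\}$; both are empty outside $\mathrm{dom}\,h$; $\mathrm{dom}\,\partial h=\{x:\partial h(x)\ne\emptyset\}$. KL exponent. A proper closed $h$ satisfies the KL property at $\hat x\in\mathrm{dom}\,\partial h$ with exponent $\alpha\in[0,1)$ if there are $a\in(0,\infty]$, $a_0>0$ and a neighborhood $V$ of $\hat x$ such that, with $\varphi(\nu)=a_0\nu^{1-\alpha}$, one has $\varphi'(h(x)-h(\hat x))\,\mathrm{dist}(0,\partial h(x))\ge1$ for all $x\in V$ with $h(\hat x)<h(x)<h(\hat x)+a$ (where the distance to the empty set is $+\infty$). *)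

(* Defs.v *)
From mathcomp Require Import all_boot all_order all_algebra.
From mathcomp Require Import all_classical all_reals all_analysis.

Set Implicit Arguments.
Unset Strict Implicit.
Unset Printing Implicit Defensive.

Import Order.TTheory GRing.Theory Num.Theory.
Import numFieldNormedType.Exports.

Local Open Scope classical_set_scope.
Local Open Scope ring_scope.

(* The library norm `|x| on matrices is the max norm, hence the Euclidean norm
   and inner product below.  The topology on 'cV[R]_m is the library one, which
   is induced by any norm. *)
Definition dotv {R : realType} {m : nat} (u v : 'cV[R]_m) : R :=
  \sum_(i < m) u i 0 * v i 0.

Definition enorm {R : realType} {m : nat} (x : 'cV[R]_m) : R :=
  Num.sqrt (\sum_(i < m) x i 0 ^+ 2).

Definition absv {R : realType} {m : nat} (y : 'cV[R]_m) : 'cV[R]_m :=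
  \col_i `|y i 0|.

Definition grad {R : realType} {m : nat} (g : 'cV[R]_m -> R) (y : 'cV[R]_m) :
    'cV[R]_m :=
  \col_i 'D_(delta_mx i 0) g y.

Definition unit_sphere {R : realType} {n : nat} : set 'cV[R]_n :=
  [set u | enorm u = 1].

Definition indicator {R : realType} {T : Type} (A : set T) (x : T) : \bar R :=
  if x \in A then 0%E else +oo%E.

(* A function on R_+ is encoded as a function on R whose values at negative
   arguments are never used. *)
Definition concave_on {R : realType} (D : set R) (phi : R -> R) : Prop :=
  @convex_function R R^o D (fun s => - phi s).

Definition strictly_concave_on {R : realType} (D : set R) (phi : R -> R) : Prop :=
  forall s t lambda : R, D s -> D t -> s != t -> 0 < lambda < 1 ->
    lambda * phi s + (1 - lambda) * phi t <
    phi (lambda * s + (1 - lambda) * t).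

Definition locally_lipschitz_on {R : realType} (D : set R) (g : R -> R) : Prop :=
  forall s, D s ->
    exists2 V : set R, nbhs s V & [lipschitz g t | t in D `&` V].

Definition right_derivative {R : realType} (phi : R -> R) (s : R) : R :=
  lim ((phi (s + h) - phi s) / h @[h --> 0^'+]).

Definition psi {R : realType} (phi : R -> R) (l : R) (s : R) : R :=
  if 0 <= s then - phi s else s ^+ 2 - l * s.

Definition Psi {R : realType} {p : nat} (phi : R -> R) (l : R)
    (y : 'cV[R]_p) : R :=
  \sum_(i < p) psi phi l (y i 0).

Definition fenchel {R : realType} (g : R -> R) (w : R) : \bar R :=
  ereal_sup [set (w * s - g s)%:E | s in [set: R]].

Definition Psi_conj {R : realType} {p : nat} (phi : R -> R) (l : R)
    (w : 'cV[R]_p) : \bar R :=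
  (\sum_(i < p) fenchel (psi phi l) (w i 0%R))%E.

Definition f_obj {R : realType} {n p : nat} (phi : R -> R) (Y : 'M[R]_(n, p))
    (x : 'cV[R]_n) : R :=
  \sum_(i < p) phi `|(Y^T *m x) i 0|.

Definition F_obj {R : realType} {n p : nat} (phi : R -> R) (Y : 'M[R]_(n, p))
    (x : 'cV[R]_n) : \bar R :=
  ((f_obj phi Y x)%:E + indicator unit_sphere x)%E.

Definition Ft_obj {R : realType} {n p : nat} (phi : R -> R) (l : R)
    (Y : 'M[R]_(n, p)) (x : 'cV[R]_n) (u : 'cV[R]_p) : \bar R :=
  (Psi_conj phi l (- u) + (dotv u (absv (Y^T *m x)))%:E
   + indicator unit_sphere x)%E.

(* A pair (x, u) in R^n * R^p is identified with the vector col_mx x u. *)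
Definition on_col_mx {R : realType} {n p : nat}
    (h : 'cV[R]_n -> 'cV[R]_p -> \bar R) (z : 'cV[R]_(n + p)) : \bar R :=
  h (usubmx z) (dsubmx z).

Definition edom {R : realType} {m : nat} (h : 'cV[R]_m -> \bar R) :
    set 'cV[R]_m :=
  [set x | (h x < +oo)%E].

Definition regular_subdiff {R : realType} {m : nat} (h : 'cV[R]_m -> \bar R)
    (x0 : 'cV[R]_m) : set 'cV[R]_m :=
  [set v | edom h x0 /\
    (0 <= limf_einf
       (fun x => (h x - h x0 - (dotv v (x - x0))%:E) *
                 (enorm (x - x0))^-1%:E) x0^')%E].

Definition limiting_subdiff {R : realType} {m : nat} (h : 'cV[R]_m -> \bar R)
    (x0 : 'cV[R]_m) : set 'cV[R]_m :=
  [set v | edom h x0 /\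
    exists xk vk : nat -> 'cV[R]_m,
      [/\ xk @ \oo --> x0,
          h (xk k) @[k --> \oo] --> h x0,
          forall k, regular_subdiff h (xk k) (vk k) &
          vk @ \oo --> v]].

Definition dom_subdiff {R : realType} {m : nat} (h : 'cV[R]_m -> \bar R) :
    set 'cV[R]_m :=
  [set x | limiting_subdiff h x !=set0].

(* The distance from 0 to the empty set is ereal_inf set0 = +oo. *)
Definition dist0 {R : realType} {m : nat} (A : set 'cV[R]_m) : \bar R :=
  ereal_inf [set (enorm v)%:E | v in A].

Definition KL_exponent {R : realType} {m : nat} (h : 'cV[R]_m -> \bar R)
    (x0 : 'cV[R]_m) (alpha : R) : Prop :=
  [/\ 0 <= alpha < 1,
      dom_subdiff h x0 &
      exists (a : \bar R) (a0 : R) (V : set 'cV[R]_m),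
        [/\ (0 < a)%E, 0 < a0, nbhs x0 V &
          forall x, V x -> (h x0 < h x)%E -> (h x < h x0 + a)%E ->
            let desing := fun nu : R => a0 * nu `^ (1 - alpha) in
            (1 <= (derive1 desing (fine (h x - h x0)))%:E *
                  dist0 (limiting_subdiff h x))%E]].

(* Main.v *)
Require Import Defs.
From mathcomp Require Import all_boot all_order all_algebra.
From mathcomp Require Import all_classical all_reals all_analysis.
From mathcomp Require Import ring lra.
Import Order.TTheory GRing.Theory Num.Theory.
Import numFieldNormedType.Exports.
Local Open Scope classical_set_scope.
Local Open Scope ring_scope.

(** Partial minimisation of the lifted function over [u] gives back [F]: by
Fenchel-Young, [Ft x u >= F x] for every [u], with equality at
[u = w(x)], where [w(x)_i = - psi' |y_i|] and [y = Y^T x].  The point of the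
theorem is thus [(xbar, w(xbar))], and the KL inequality has to be carried from
[F] to [Ft].

Near that point every [- u_i] is a slope [psi' t_i] of the strictly convex
function [psi], and [psi'] is Lipschitz.  Let [(xi, eta)] be a regular
subgradient of [Ft] at [(x, u)].  Three facts about it carry the proof.
- Moving [u] alone gives [eta_i = |y_i| - t_i] ([regular_subdiff_Ft_u]).
- The gap [Ft x u - F x] is a sum of Bregman-type terms of [psi] between
  [|y_i|] and [t_i], hence at most [K |eta|^2] ([Ft_obj_gap]).
- There is a regular subgradient of [F] at [x] of norm at most
  [C |(xi, eta)|] ([regular_subdiff_project]).  To obtain it, scale [xi] by a
  number [rho] between [0] and [1] such that [w(x) - rho u >= 0], and linearise
  the convex function [<w(x) - rho u, |Y^T .|>] at [x] by the signs of [y].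
  As [|w(x) - u|] is of order [|eta|], so is [1 - rho]
  ([regular_lift_estimate]).

Put [nu = Ft x u - F xbar].  Either the gap is at least half of [nu], and
[nu <= 2 K |eta|^2] gives [nu^alpha <= sqrt nu <= C' |eta|] since
[1/2 <= alpha] and [nu <= 1]; or [F x - F xbar >= nu / 2] and the KL inequality of [F]
applies ([KL_exponent_lift]).  An inequality [nu^alpha <= c |v|] over regular
subgradients passes to limiting ones by continuity
([KL_exponent_of_regular]). *)

Set Implicit Arguments.
Unset Strict Implicit.

(** * The Euclidean norm and the topology of column vectors *)

Section Euclidean.
Context {R : realType}.

Lemma enorm_ge0 m (x : 'cV[R]_m) : 0 <= enorm x.
Proof. exact: sqrtr_ge0. Qed.

Lemma sqr_enorm m (x : 'cV[R]_m) : enorm x ^+ 2 = \sum_(i < m) x i 0 ^+ 2.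
Proof. by rewrite sqr_sqrtr// sumr_ge0// => i _; rewrite sqr_ge0. Qed.

Lemma coord_le_enorm m (x : 'cV[R]_m) i : `|x i 0| <= enorm x.
Proof.
rewrite -(@ler_pXn2r _ 2)// ?nnegrE ?enorm_ge0// sqr_enorm real_normK ?num_real//.
by rewrite (bigD1 i)//= lerDl sumr_ge0// => j _; rewrite sqr_ge0.
Qed.

Lemma enorm_le_sum m (x : 'cV[R]_m) : enorm x <= \sum_(i < m) `|x i 0|.
Proof.
have S0 : 0 <= \sum_(i < m) `|x i 0| by exact: sumr_ge0.
rewrite -(@ler_pXn2r _ 2)// ?nnegrE ?enorm_ge0// sqr_enorm.
rewrite expr2 mulr_suml ler_sum// => i _.
rewrite -(real_normK (num_real (x i 0))) expr2 ler_wpM2l//.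
by rewrite (bigD1 i)//= lerDl sumr_ge0.
Qed.

(** The dimension as a constant is harmless, as a KL exponent is insensitive to
multiplicative constants. *)
Lemma enorm_bound m (x : 'cV[R]_m) (c : R) :
  (forall i, `|x i 0| <= c) -> enorm x <= m%:R * c.
Proof.
move=> xc; apply: (le_trans (enorm_le_sum _)).
apply: (@le_trans _ _ (\sum_(i < m) c)); first exact: ler_sum.
by rewrite sumr_const card_ord mulr_natl.
Qed.

Lemma enorm0 m : enorm (0 : 'cV[R]_m) = 0.
Proof.
rewrite /enorm big1 ?sqrtr0// => i _; by rewrite mxE expr0n.
Qed.

Lemma enorm_gt0 m (x : 'cV[R]_m) : x != 0 -> 0 < enorm x.
Proof.
move=> x0; rewrite lt0r enorm_ge0 andbT; apply: contra x0 => /eqP e0.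
apply/eqP/colP => i; rewrite mxE; apply/normr0_eq0/le_anti.
by rewrite normr_ge0 andbT -e0 coord_le_enorm.
Qed.

Lemma sqr_enorm_col_mx n p (x : 'cV[R]_n) (u : 'cV[R]_p) :
  enorm (col_mx x u) ^+ 2 = enorm x ^+ 2 + enorm u ^+ 2.
Proof.
rewrite !sqr_enorm big_split_ord/=.
by congr (_ + _); apply: eq_bigr => i _; rewrite ?col_mxEu ?col_mxEd.
Qed.

Lemma enorm_col_mxl n p (x : 'cV[R]_n) (u : 'cV[R]_p) :
  enorm x <= enorm (col_mx x u).
Proof.
by rewrite -(@ler_pXn2r _ 2)// ?nnegrE ?enorm_ge0// sqr_enorm_col_mx lerDl sqr_ge0.
Qed.

Lemma enorm_col_mxr n p (x : 'cV[R]_n) (u : 'cV[R]_p) :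
  enorm u <= enorm (col_mx x u).
Proof.
by rewrite -(@ler_pXn2r _ 2)// ?nnegrE ?enorm_ge0// sqr_enorm_col_mx lerDr sqr_ge0.
Qed.

Lemma enorm_col_mx0 n p (x : 'cV[R]_n) : enorm (col_mx x (0 : 'cV[R]_p)) = enorm x.
Proof.
apply/(@pexpIrn _ 2) => //; rewrite ?nnegrE ?enorm_ge0//.
by rewrite sqr_enorm_col_mx enorm0 expr0n addr0.
Qed.

Lemma enorm_col_0mx n p (u : 'cV[R]_p) : enorm (col_mx (0 : 'cV[R]_n) u) = enorm u.
Proof.
apply/(@pexpIrn _ 2) => //; rewrite ?nnegrE ?enorm_ge0//.
by rewrite sqr_enorm_col_mx enorm0 expr0n add0r.
Qed.

Lemma enorm_delta m (i : 'I_m) (c : R) : enorm (c *: delta_mx i 0 : 'cV_m) = `|c|.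
Proof.
rewrite -sqrtr_sqr /enorm; congr Num.sqrt.
rewrite (bigD1 i)//= big1 => [|j ji]; rewrite !mxE ?eqxx.
  by rewrite mulr1 addr0.
by rewrite (negPf ji) mulr0 expr0n.
Qed.

(** The topology is given by the max norm, to which the Euclidean norm is
equivalent; after this lemma all neighbourhoods are Euclidean balls. *)
Lemma nbhs_enormP m (x0 : 'cV[R]_m) (V : set 'cV[R]_m) :
  nbhs x0 V <-> exists2 d : R, 0 < d & forall x, enorm (x - x0) < d -> V x.
Proof.
split=> [/nbhs_ballP[e /= e0 eV]|[d d0 dV]].
  exists e => // x xe; apply: eV; rewrite -ball_normE/= distrC.
  rewrite [ltLHS]mx_normrE; apply: bigmax_lt => //= -[i j] _; rewrite ord1/=.
  exact: le_lt_trans (coord_le_enorm _ i) xe.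
apply/nbhs_ballP; exists (d / m.+1%:R) => /=; first by rewrite divr_gt0.
move=> x [_ bx]; apply: dV; apply: (@le_lt_trans _ _ (m%:R * (d / m.+1%:R))).
  apply: enorm_bound => i; have := bx i 0.
  by rewrite /ball/= !mxE distrC => /ltW.
rewrite mulrCA -[ltRHS]mulr1 ltr_pM2l// ltr_pdivrMr// mul1r ltr_nat//.
Qed.

Lemma cvg_enorm_sub m (xk : nat -> 'cV[R]_m) (x : 'cV[R]_m) (d : R) : 0 < d ->
  xk @ \oo --> x -> \forall k \near \oo, enorm (xk k - x) < d.
Proof. by move=> d0 xx; apply: (xx [set y | enorm (y - x) < d]); apply/nbhs_enormP; exists d. Qed.

Lemma cvg_col m (xk : nat -> 'cV[R]_m) (x : 'cV[R]_m) :
  (forall i, xk k i 0 @[k --> \oo] --> x i 0) -> xk @ \oo --> x.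
Proof.
move=> H V /nbhs_ballP[e /= e0 eV].
have : \forall k \near \oo, forall i, ball (x i 0) e (xk k i 0).
  by apply: filter_forall => i; apply: H; exact: nbhsx_ballx.
apply: filterS => k bk; apply: eV; split => // i j; rewrite ord1; exact: bk.
Qed.

Lemma cvg_coord m (xk : nat -> 'cV[R]_m) (x : 'cV[R]_m) i :
  xk @ \oo --> x -> xk k i 0 @[k --> \oo] --> x i 0.
Proof. by move=> xx; exact: (cvg_comp _ _ xx (@coord_continuous _ _ _ i 0 x)). Qed.

Lemma cvg_enorm m (xk : nat -> 'cV[R]_m) (x : 'cV[R]_m) :
  xk @ \oo --> x -> enorm (xk k) @[k --> \oo] --> enorm x.
Proof.
move=> xx; apply: (@cvg_comp _ _ _ (fun k => \sum_(i < m) xk k i 0 ^+ 2) Num.sqrt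
  _ (nbhs (\sum_(i < m) x i 0 ^+ 2))); last exact: sqrt_continuous.
apply: cvg_big => [z|i _].
  by apply: (@cvgD R R^o); [exact: cvg_fst|exact: cvg_snd].
exact: (cvg_comp _ _ (cvg_coord (i := i) xx) (@exprn_continuous R 2 (x i 0))).
Qed.

Lemma dotv_col_mx n p (a x : 'cV[R]_n) (b u : 'cV[R]_p) :
  dotv (col_mx a b) (col_mx x u) = dotv a x + dotv b u.
Proof.
rewrite /dotv big_split_ord/=.
by congr (_ + _); apply: eq_bigr => i _; rewrite ?col_mxEu ?col_mxEd.
Qed.

Lemma dotvDl m (a b x : 'cV[R]_m) : dotv (a + b) x = dotv a x + dotv b x.
Proof. by rewrite -big_split; apply: eq_bigr => i _; rewrite mxE mulrDl. Qed.

Lemma dotvZl m c (a x : 'cV[R]_m) : dotv (c *: a) x = c * dotv a x.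
Proof. by rewrite /dotv mulr_sumr; apply: eq_bigr => i _; rewrite mxE mulrA. Qed.

Lemma dotv_mulmxl n p (Y : 'M[R]_(n, p)) a x :
  dotv (Y *m a) x = dotv a (Y^T *m x).
Proof.
rewrite /dotv.
under eq_bigr => i _ do rewrite mxE mulr_suml.
rewrite exchange_big/=; apply: eq_bigr => j _.
rewrite mxE mulr_sumr; apply: eq_bigr => i _; rewrite mxE; ring.
Qed.

Lemma enorm_mulmx_bound n p (Y : 'M[R]_(n, p)) : exists2 B : R, 0 < B &
  forall (v : 'cV[R]_p) c, 0 <= c -> (forall i, `|v i 0| <= c) -> enorm (Y *m v) <= B * c.
Proof.
exists (1 + \sum_i \sum_j `|Y i j|).
  by rewrite ltr_pwDl// sumr_ge0// => i _; exact: sumr_ge0.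
move=> v c c0 vc; apply: (le_trans (enorm_le_sum _)).
rewrite mulrDl mul1r ler_wpDl// mulr_suml ler_sum// => i _.
rewrite mxE (le_trans (ler_norm_sum _ _ _))// mulr_suml ler_sum// => j _.
by rewrite normrM ler_wpM2l.
Qed.

Lemma enormZD m c (a b : 'cV[R]_m) : 0 <= c <= 1 ->
  enorm (c *: a + b) <= m%:R * (enorm a + enorm b).
Proof.
move=> /andP[c0 c1]; apply: enorm_bound => i; rewrite !mxE.
apply: (le_trans (ler_normD _ _)); apply: lerD (coord_le_enorm _ _).
rewrite normrM ger0_norm// (le_trans _ (coord_le_enorm _ i))//.
by rewrite ler_piMl.
Qed.

End Euclidean.

(** * Regular subgradients by first-order minorants *)

Section RegularSubdifferential.
Context {R : realType} {m : nat}.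
Implicit Types (h : 'cV[R]_m -> \bar R) (x v : 'cV[R]_m).

(** The lower limit of the difference quotients being nonnegative means that, up to
any [eps * enorm (x - x0)], the affine function of slope [v] is a local minorant.
In this form points where [h] is infinite need no separate treatment. *)
Lemma regular_subdiffP h x0 v (r : R) : h x0 = r%:E ->
  regular_subdiff h x0 v <->
  forall eps : R, 0 < eps -> exists2 d : R, 0 < d & forall x, enorm (x - x0) < d ->
    ((r + dotv v (x - x0) - eps * enorm (x - x0))%:E <= h x)%E.
Proof.
move=> hr; rewrite /regular_subdiff/= /edom/= hr ltry.
set q := fun x => _.
have qE x : q x = ((h x - r%:E - (dotv v (x - x0))%:E) * (enorm (x - x0))^-1%:E)%E by [].
split=> [[_ le0] eps eps0|H].
  have [A nA Ainf] : exists2 A, x0^' A & ((- eps)%:E < ereal_inf (q @` A))%E.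
    have : ((- eps)%:E < limf_einf q x0^')%E.
      by apply: lt_le_trans le0; rewrite lte_fin oppr_lt0.
    rewrite limf_einfE => /ereal_sup_gt[_ [A nA <-]] lA; exists A => //.
  move: nA; rewrite /dnbhs /within/= => /nbhs_enormP[d d0 dA].
  exists d => // x xd; have [->|xx0] := eqVneq x x0.
    rewrite hr subrr enorm0 mulr0 subr0 lee_fin /dotv big1 ?addr0// => i _.
    by rewrite mxE mulr0.
  have e0 : 0 < enorm (x - x0) by rewrite enorm_gt0// subr_eq0.
  have : ((- eps)%:E < q x)%E.
    by apply: (lt_le_trans Ainf); apply: ereal_inf_lbound; exists x => //; exact: dA.
  rewrite qE; case: (h x) => [s| |] //=.
  - rewrite -!EFinB -EFinM lte_fin lee_fin ltr_pdivlMr//; lra.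
  - by move=> _; rewrite leey.
  - by rewrite gt0_mulNye ?lte_fin ?invr_gt0// ltNge leNye.
split=> //; apply/lee_subgt0Pr => eps eps0.
have [d d0 dH] := H _ eps0.
rewrite sub0e limf_einfE.
apply: (@le_trans _ _ (ereal_inf (q @` [set x | enorm (x - x0) < d /\ x != x0]))); last first.
  apply: ereal_sup_ubound; exists [set x | enorm (x - x0) < d /\ x != x0] => //.
  by rewrite /dnbhs /within/=; apply/nbhs_enormP; exists d.
apply: le_ereal_inf_tmp => _ [x /= [xd xx0] <-]; rewrite qE.
have e0 : 0 < enorm (x - x0) by rewrite enorm_gt0// subr_eq0.
have := dH _ xd; case: (h x) => [s| |] //=.
- rewrite -!EFinB -EFinM !lee_fin ler_pdivlMr//; lra.
- by move=> _; rewrite gt0_mulye ?leey// lte_fin invr_gt0.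
Qed.

Lemma regular_subdiff_limiting h x v : regular_subdiff h x v -> limiting_subdiff h x v.
Proof.
move=> xv; split; first by case: xv.
by exists (fun=> x), (fun=> v); split=> //; exact: cvg_cst.
Qed.

Lemma dist0_le (A : set 'cV[R]_m) v : A v -> (dist0 A <= (enorm v)%:E)%E.
Proof. by move=> Av; apply: ereal_inf_lbound; exists v. Qed.

End RegularSubdifferential.

(** * The concave penalty and its convex extension [psi] *)

Lemma derivable_quotient_near {R : realType} (f : R -> R) (s : R) :
  derivable f s 1 -> forall e : R, 0 < e -> exists2 d : R, 0 < d &
  forall h, h != 0 -> `|h| < d -> `|(f (h + s) - f s) / h - derive1 f s| < e.
Proof.
move=> df e e0.
have : h^-1 *: (f (h *: 1 + s) - f s) @[h --> 0^'] --> derive1 f s.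
  by rewrite derive1E; exact: df.
move=> /cvgrPdist_lt/(_ _ e0); rewrite near_withinE => /nbhs_normP[d /= d0 dH].
exists d => // h h0 hd; rewrite distrC mulrC.
have := dH h; rewrite /= sub0r normrN => /(_ hd h0).
by rewrite /GRing.scale/= mulr1.
Qed.

(** The derivative of [psi].  The right derivative of [phi] makes sense at [0] too, where
it equals [l]; this is what glues the two branches. *)
Definition dpsi {R : realType} (phi : R -> R) (l s : R) : R :=
  if 0 <= s then - right_derivative phi s else 2 * s - l.

Section ConcavePenalty.
Context {R : realType} (phi : R -> R) (l : R).
Hypothesis phi_ge0 : forall s : R, 0 <= s -> 0 <= phi s.
Hypothesis phi_cont : {within `[0, +oo[, continuous phi}.
Hypothesis phi0 : phi 0 = 0.
Hypothesis phi_diff : forall s : R, 0 < s -> derivable phi s 1.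
Hypothesis phi_l : derive1 phi s @[s --> 0^'+] --> l.
Hypothesis phi_sconcave : strictly_concave_on `[0, +oo[ phi.
Hypothesis phi_lip : locally_lipschitz_on `[0, +oo[ (right_derivative phi).

Let rd := right_derivative phi.
Let g := dpsi phi l.

Let in_Rge0 (s : R) : 0 <= s -> [set` `[0, +oo[%R] s.
Proof. by move=> s0; rewrite /= in_itv/= s0. Qed.

Lemma right_derivative_gt0 s : 0 < s -> rd s = derive1 phi s.
Proof.
move=> s0; rewrite /rd /right_derivative; apply/cvg_lim => //.
apply/cvgrPdist_lt => e e0.
have [d d0 dH] := derivable_quotient_near (phi_diff s0) e0.
near=> h.
have h0 : 0 < h by near: h; exact: nbhs_right_gt.
rewrite distrC (addrC s); apply: dH; first by rewrite gt_eqF.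
rewrite gtr0_norm//; near: h; exact: nbhs_right_lt.
Unshelve. all: by end_near. Qed.

(** Strict concavity on the segment from [s] to [t], divided by the length of a small
step, compares the chord with a difference quotient, which tends to the slope. *)
Lemma tangent_gt0 s t : 0 < s -> 0 <= t -> phi t <= phi s + derive1 phi s * (t - s).
Proof.
move=> s0 t0; have [->|ts] := eqVneq t s; first by rewrite subrr mulr0 addr0.
have ts0 : 0 < `|t - s| by rewrite normr_gt0 subr_eq0.
rewrite -lerBlDl; apply/ler_addgt0Pr => e e0.
have [d d0 dH] := derivable_quotient_near (phi_diff s0) (divr_gt0 e0 ts0).
(* The step lam * (t - s) stays in the range d of the difference quotient. *)
pose lam := Num.min 2^-1 (d / (2 * `|t - s|)).
have lam0 : 0 < lam by rewrite lt_min invr_gt0 ltr0n/= divr_gt0// mulr_gt0.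
have lam1 : lam < 1 by rewrite gt_min invf_lt1// ltr1n.
have hd : `|lam * (t - s)| < d.
  rewrite normrM gtr0_norm// (@le_lt_trans _ _ (d / 2))//; last first.
    by rewrite ltr_pdivrMr// mulr_natr mulr2n ltrDl.
  rewrite -ler_pdivlMr// (@le_trans _ _ (d / (2 * `|t - s|)))//; first by rewrite ge_min lexx orbT.
  by rewrite invfM mulrA.
have h0 : lam * (t - s) != 0 by rewrite mulf_eq0 negb_or subr_eq0 ts gt_eqF.
have sc := phi_sconcave (in_Rge0 t0) (in_Rge0 (ltW s0)) ts (introT andP (conj lam0 lam1)).
have := dH _ h0 hd.
rewrite (_ : lam * (t - s) + s = lam * t + (1 - lam) * s); last ring.
set P := phi (_ + _) in sc *.
set D := derive1 phi s.
have Ple : phi t - phi s <= (P - phi s) / (lam * (t - s)) * (t - s).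
  rewrite (_ : _ / _ * _ = (P - phi s) / lam); last first.
    by field; rewrite subr_eq0 ts gt_eqF.
  by rewrite ler_pdivlMr//; lra.
rewrite ltr_pdivlMr// -normrM mulrBl => /ltW; set Q := _ / _ * _ in Ple *.
move=> /(le_trans (ler_norm _)); lra.
Qed.

(** The tangent inequality at [s], in the limit [s -> 0+]. *)
Lemma phi_le_linear t : 0 <= t -> phi t <= l * t.
Proof.
move=> t0.
have c0 : phi s @[s --> 0^'+] --> (0 : R).
  have /continuous_within_itvcyP[_] := phi_cont; by rewrite phi0.
have lim_t : phi s + derive1 phi s * (t - s) @[s --> 0^'+] --> 0 + l * (t - 0).
  apply: cvgD => //; apply: cvgM => //; apply: cvgB; first exact: cvg_cst.
  exact: cvg_at_right_filter.
rewrite -[_ * _]add0r -[in leRHS](subr0 t) -(cvg_lim (@Rhausdorff R) lim_t).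
apply: limr_ge; first by apply/cvg_ex; eexists; exact: lim_t.
near=> s; apply: tangent_gt0 => //; near: s; exact: nbhs_right_gt.
Unshelve. all: by end_near. Qed.

(** The quotient [phi h / h] is squeezed between [derive1 phi h], by the tangent at [h]
evaluated at [0], and [l]. *)
Lemma right_derivative0 : rd 0 = l.
Proof.
apply/cvg_lim => //; apply: (squeeze_cvgr _ phi_l (cvg_cst l)).
near=> h; have h0 : 0 < h by near: h; exact: nbhs_right_gt.
rewrite add0r phi0 subr0 ler_pdivlMr// ler_pdivrMr//.
have := tangent_gt0 h0 (lexx 0); have := phi_le_linear (ltW h0); rewrite phi0.
by move=> ? ?; apply/andP; split; lra.
Unshelve. all: by end_near. Qed.

Lemma tangent s t : 0 <= s -> 0 <= t -> phi t <= phi s + rd s * (t - s).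
Proof.
rewrite le0r => /predU1P[->|s0] t0; last by rewrite right_derivative_gt0// tangent_gt0.
by rewrite right_derivative0 phi0 add0r subr0 phi_le_linear.
Qed.

(** If two slopes coincided, the two tangent inequalities evaluated at the midpoint would
contradict strict concavity. *)
Lemma right_derivative_anti s t : 0 <= s -> s < t -> rd t < rd s.
Proof.
move=> s0 st; have t0 : 0 <= t by rewrite (le_trans s0)// ltW.
have h2 : 0 < (2^-1 : R) < 1 by apply/andP; split; lra.
have sc := phi_sconcave (in_Rge0 s0) (in_Rge0 t0) (negbT (lt_eqF st)) h2.
have m0 : 0 <= 2^-1 * s + (1 - 2^-1) * t by lra.
have := tangent s0 m0; have := tangent t0 m0.
set P := phi (_ + _) in sc *; nra.
Qed.

(** A nonpositive slope would be followed by a negative one, along which [phi] would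
fall below [0]. *)
Lemma right_derivative_pos s : 0 <= s -> 0 < rd s.
Proof.
move=> s0; rewrite ltNge; apply/negP => rs0.
have s1 : 0 <= s + 1 by lra.
have c0 : rd (s + 1) < 0 by apply: lt_le_trans rs0; apply: right_derivative_anti => //; lra.
have c0N : 0 < - rd (s + 1) by lra.
have P0 : 0 <= phi (s + 1) by exact: phi_ge0.
(* The tangent at s + 1 takes the value -1 at this point. *)
pose t := s + 1 + (phi (s + 1) + 1) / - rd (s + 1).
have q0 : 0 < (phi (s + 1) + 1) / - rd (s + 1) by rewrite divr_gt0//; lra.
have t0 : 0 <= t by rewrite /t; lra.
have := tangent s1 t0; have := phi_ge0 t0.
rewrite (_ : rd (s + 1) * (t - (s + 1)) = - (phi (s + 1) + 1)); last first.
  by rewrite /t; field; rewrite lt_eqF.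
lra.
Qed.

(** Convexity of [psi] in the only form used later: a global affine minorant of slope
[dpsi] at each point. *)
Lemma psi_tangent s t : psi phi l s + g s * (t - s) <= psi phi l t.
Proof.
rewrite /psi /g /dpsi -/rd; case: (leP 0 s) => s0; case: (leP 0 t) => t0.
- have := tangent s0 t0; lra.
- have T0 : rd s * s <= phi s.
    by have := tangent s0 (lexx 0); rewrite phi0 sub0r mulrN subr_ge0.
  have rl : rd s <= l.
    rewrite -right_derivative0; move: s0; rewrite le0r => /predU1P[->//|s0].
    by apply/ltW/right_derivative_anti.
  nra.
- have := phi_le_linear t0; nra.
- have := sqr_ge0 (s - t); nra.
Qed.

Lemma dpsi_incr s t : s < t -> g s < g t.
Proof.
rewrite /g /dpsi -/rd => st; case: (leP 0 s) => s0; case: (leP 0 t) => t0.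
- by rewrite ltrN2 right_derivative_anti.
- lra.
- have : rd t <= l.
    rewrite -right_derivative0; move: t0; rewrite le0r => /predU1P[->//|t0].
    by apply/ltW/right_derivative_anti.
  lra.
- lra.
Qed.

Lemma dpsi_lt0 s : 0 <= s -> g s < 0.
Proof. by move=> s0; rewrite /g /dpsi s0 oppr_lt0 right_derivative_pos. Qed.

(** At [0] the Lipschitz constants of the two branches, which agree there, are combined
by passing through [0]. *)
Lemma dpsi_locally_lipschitz s0 : exists r L : R, [/\ 0 < r, 0 < L &
  forall s t, `|s - s0| < r -> `|t - s0| < r -> `|g s - g t| <= L * `|s - t|].
Proof.
have [s00|s00] := leP 0 s0; last first.
  exists (- s0), 2; split; [lra|lra|] => s t; rewrite !ltr_norml => /andP[_ s1] /andP[_ t1].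
  rewrite /g /dpsi !ifF; [|lra|lra].
  have -> : 2 * s - l - (2 * t - l) = 2 * (s - t) by ring.
  by rewrite normrM ger0_norm.
have [V /nbhs_normP[r /= r0 rV] [M [_ MH]]] := phi_lip (in_Rge0 s00).
pose L := Num.max 2 (M + 1).
have L2 : 2 <= L by rewrite le_max lexx.
have rdL s t : 0 <= s -> 0 <= t -> `|s - s0| < r -> `|t - s0| < r ->
    `|rd s - rd t| <= L * `|s - t|.
  move=> s1 t1 sr tr; have ML : M < L by rewrite lt_max ltrDl ltr01 orbT.
  apply: (MH L ML (s, t)) => /=.
  by split; split; rewrite ?in_itv/= ?s1 ?t1//; apply: rV; rewrite /= distrC.
exists r, L; split=> //; first lra.
have mixed s t : s < 0 -> 0 <= t -> `|s - s0| < r -> `|t - s0| < r ->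
    `|g s - g t| <= L * `|s - t|.
  move=> s1 t1 sr tr; rewrite /g /dpsi -/rd t1 ifF; last lra.
  have r00 : `|0 - s0| < r by move: sr; rewrite !ltr_norml => /andP[? ?]; apply/andP; split; lra.
  have := rdL _ _ (lexx 0) t1 r00 tr; rewrite right_derivative0.
  rewrite !ler_norml sub0r normrN (ger0_norm t1) (@ltr0_norm _ (s - t)); last lra.
  by move=> /andP[? ?]; apply/andP; split; nra.
move=> s t sr tr; case: (leP 0 s) => s1; case: (leP 0 t) => t1.
- rewrite /g /dpsi -/rd s1 t1 (_ : - rd s - - rd t = - (rd s - rd t)) ?normrN; last ring.
  exact: rdL.
- by rewrite distrC (distrC s); exact: mixed.
- exact: mixed.
- rewrite /g /dpsi !ifF; [|lra|lra].
  have -> : 2 * s - l - (2 * t - l) = 2 * (s - t) by ring.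
  rewrite normrM ger0_norm//; by rewrite ler_wpM2r.
Qed.

Lemma dpsi_continuous : continuous g.
Proof.
move=> s; have [r [L [r0 L0 H]]] := dpsi_locally_lipschitz s.
apply/cvgrPdist_lt => e e0; near=> t.
have tr : `|t - s| < r.
  by rewrite distrC; near: t; apply/nbhs_normP; exists r.
apply: le_lt_trans (H s t _ tr) _; first by rewrite subrr normr0.
rewrite mulrC -ltr_pdivlMr//; near: t; apply/nbhs_normP.
by exists (e / L) => //=; rewrite divr_gt0.
Unshelve. all: by end_near. Qed.

(** The tangent inequalities at the two ends of a step enclose the difference quotient
between two values of [dpsi], and [dpsi] is continuous. *)
Lemma grad_Psi p (y : 'cV[R]_p) i : grad (Psi phi l) y i 0 = g (y i 0).
Proof.
rewrite mxE /derive; apply/cvg_lim => //.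
have -> : (fun h : R => h^-1 *: ((Psi phi l \o shift y) (h *: delta_mx i 0) - Psi phi l y)) =
          (fun h : R => h^-1 * (psi phi l (h + y i 0) - psi phi l (y i 0))).
  apply/funext => h /=; rewrite /Psi (bigD1 i)//= [in X in _ - X](bigD1 i)//=.
  rewrite !mxE !eqxx mulr1.
  under eq_bigr => j ji do rewrite !mxE (negPf ji) mulr0 add0r.
  by rewrite opprD addrACA subrr addr0.
set s := y i 0.
apply/cvgrPdist_le => e e0.
have /cvgrPdist_le /(_ _ e0) /nbhs_normP[d d0 dH] := @dpsi_continuous s.
rewrite near_withinE; apply/nbhs_normP; exists d => // h /=; rewrite sub0r normrN => hd h0.
have := dH (h + s); rewrite /= opprD addrCA subrr addr0 normrN => /(_ hd).
have := psi_tangent s (h + s); have := psi_tangent (h + s) s.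
rewrite (_ : s - (h + s) = - h) ?addrK; last ring.
set P := psi _ _ (h + s); set Q := psi _ _ s => T1 T2.
rewrite !ler_norml => /andP[? ?].
have [h1|h1|h1] := ltgtP h 0; last by rewrite h1 eqxx in h0.
- have : g (h + s) <= h^-1 * (P - Q) <= g s.
    rewrite mulrC ler_ndivlMr// ler_ndivrMr//; apply/andP; split; lra.
  by move=> /andP[? ?]; apply/andP; split; lra.
- have : g s <= h^-1 * (P - Q) <= g (h + s).
    rewrite mulrC ler_pdivlMr// ler_pdivrMr//; apply/andP; split; lra.
  by move=> /andP[? ?]; apply/andP; split; lra.
Qed.

(** Near [(s0, - dpsi s0)] the multiplier [u] is bounded away from [0] and infinity, and
[- u] is a slope [g t] with [t] in the range where [g] is Lipschitz; [t] comes from the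
intermediate value theorem.  All the constants are expressed through one [K], and the
statement holds for all large [K], so that finitely many coordinates can share it. *)
Lemma dpsi_local s0 : 0 <= s0 -> \forall K \near +oo, forall a u : R,
  `|a - s0| < K^-1 -> `|u + g s0| < K^-1 ->
  [/\ K^-1 <= u, u <= K & exists2 t, g t = - u & `|g t - g a| <= K * `|t - a|].
Proof.
move=> s00; have [r [L [r0 L0 Lip]]] := dpsi_locally_lipschitz s0.
have gs := dpsi_lt0 s00.
pose r2 := r / 2; have r20 : 0 < r2 by rewrite divr_gt0.
have r2r : r2 < r by rewrite /r2; lra.
have gu : g s0 < g (s0 + r2) by apply: dpsi_incr; lra.
have gd : g (s0 - r2) < g s0 by apply: dpsi_incr; lra.
pose K0 := r^-1 + L + (g (s0 + r2) - g s0)^-1 + (g s0 - g (s0 - r2))^-1 + 2 / - g s0 - g s0 + 1.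
have i1 : 0 < r^-1 by rewrite invr_gt0.
have i2 : 0 < (g (s0 + r2) - g s0)^-1 by rewrite invr_gt0; lra.
have i3 : 0 < (g s0 - g (s0 - r2))^-1 by rewrite invr_gt0; lra.
have i4 : 0 < 2 / - g s0 by rewrite divr_gt0//; lra.
near=> K => a u.
have KK0 : K0 <= K by near: K; apply: nbhs_pinfty_ge; exact: num_real.
have K1 : 1 <= K by rewrite /K0 in KK0; lra.
have K0' : 0 < K by lra.
have invK c : 0 < c -> c^-1 <= K -> K^-1 <= c.
  by move=> c0 cK; rewrite -[c]invrK lef_pV2// posrE ?invr_gt0.
have Kr : K^-1 <= r by apply: invK => //; rewrite /K0 in KK0; lra.
have Ku : K^-1 <= g (s0 + r2) - g s0 by apply: invK; rewrite /K0 in KK0; lra.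
have Kd : K^-1 <= g s0 - g (s0 - r2) by apply: invK; rewrite /K0 in KK0; lra.
have Kg : K^-1 <= - g s0 / 2.
  by apply: invK; rewrite ?invf_div; rewrite /K0 in KK0; lra.
have Kinv1 : K^-1 <= 1 by apply: invK => //; rewrite invr1.
move=> aK; rewrite ltr_norml => /andP[u1 u2]; split; [lra|rewrite /K0 in KK0; lra|].
have s01 : s0 - r2 <= s0 + r2 by lra.
have mm : Num.min (g (s0 - r2)) (g (s0 + r2)) <= - u <= Num.max (g (s0 - r2)) (g (s0 + r2)).
  by rewrite ge_min le_max; apply/andP; split; apply/orP; [left|right]; lra.
have [t] := IVT s01 (continuous_subspaceT dpsi_continuous) mm.
rewrite in_itv/= => /andP[t1 t2] gt; exists t => //.
apply: le_trans (Lip _ _ _ _) _.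
- by rewrite ltr_norml; apply/andP; split; lra.
- exact: lt_le_trans aK Kr.
- by rewrite ler_wpM2r//; rewrite /K0 in KK0; lra.
Unshelve. all: by end_near. Qed.

End ConcavePenalty.

(** * The lifted function and its regular subgradients *)

Section Lift.
Context {R : realType} {n p : nat} (Y : 'M[R]_(n, p)) (phi : R -> R) (l : R).
Variable g : R -> R.
Hypothesis g_tangent : forall s t, psi phi l s + g s * (t - s) <= psi phi l t.
Hypothesis g_incr : forall s t, s < t -> g s < g t.
Hypothesis g_cont : continuous g.

Let a (x : 'cV[R]_n) (i : 'I_p) : R := `|(Y^T *m x) i 0|.
Implicit Types (x xi : 'cV[R]_n) (u eta : 'cV[R]_p).
Local Notation F := (F_obj phi Y).
Local Notation Ft := (Ft_obj phi l Y).
Local Notation Ftz := (on_col_mx (Ft_obj phi l Y)).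

Lemma fenchel_young w s : ((w * s - psi phi l s)%:E <= fenchel (psi phi l) w)%E.
Proof. by apply: ereal_sup_ubound; exists s. Qed.

Lemma fenchel_slope t : fenchel (psi phi l) (g t) = (g t * t - psi phi l t)%:E.
Proof.
apply/le_anti; rewrite fenchel_young andbT.
apply: ge_ereal_sup => _ [s _ <-]; rewrite lee_fin.
have := g_tangent t s; lra.
Qed.

Lemma f_objE x : f_obj phi Y x = - \sum_i psi phi l (a x i).
Proof. by rewrite -sumrN; apply: eq_bigr => i _; rewrite /psi normr_ge0 opprK. Qed.

Lemma F_objE x : unit_sphere x -> F x = (f_obj phi Y x)%:E.
Proof. by move=> xM; rewrite /F_obj /indicator mem_set// adde0. Qed.

Lemma F_obj_out x : ~ unit_sphere x -> F x = +oo%E.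
Proof. by move=> xM; rewrite /F_obj /indicator memNset// addey. Qed.

Lemma Psi_conj_ge x u :
  ((\sum_i (- u i 0 * a x i - psi phi l (a x i)))%:E <= Psi_conj phi l (- u))%E.
Proof.
by rewrite -sumEFin; apply: lee_sum => i _; rewrite mxE; exact: fenchel_young.
Qed.

Lemma F_le_Ft x u : (F x <= Ft x u)%E.
Proof.
have [xM|xM] := pselect (unit_sphere x).
  rewrite F_objE// /Ft_obj /indicator mem_set// adde0 -leeBlDr//.
  apply: le_trans (Psi_conj_ge x u); rewrite -EFinB lee_fin f_objE /dotv.
  rewrite -sumrN -sumrB; apply: ler_sum => i _.
  by rewrite mxE -/(a x i); lra.
rewrite F_obj_out// /Ft_obj /indicator memNset// addey//.
have := Psi_conj_ge x u; by case: (Psi_conj _ _ _).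
Qed.

Lemma Ft_objE x u (t : 'I_p -> R) : unit_sphere x ->
  (forall i, g (t i) = - u i 0) ->
  Ft x u = (\sum_i (g (t i) * t i - psi phi l (t i) + u i 0 * a x i))%:E.
Proof.
move=> xM gt; rewrite /Ft_obj /indicator mem_set// adde0 /Psi_conj.
rewrite big_split/= EFinD -[in RHS]sumEFin; congr (_ + _)%E.
  by apply: eq_bigr => i _; rewrite mxE -gt fenchel_slope.
by congr EFin; apply: eq_bigr => i _; rewrite mxE.
Qed.

Lemma unit_sphere_dom x u : (Ft x u < +oo)%E -> unit_sphere x.
Proof.
move=> H; apply: contrapT => xM.
by have := le_lt_trans (F_le_Ft x u) H; rewrite F_obj_out.
Qed.

Lemma Ft_obj_argmin x : unit_sphere x -> Ft x (\col_i - g (a x i)) = F x.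
Proof.
move=> xM; rewrite F_objE// (Ft_objE (t := a x))//; last first.
  by move=> i; rewrite mxE opprK.
rewrite f_objE -sumrN; congr EFin; apply: eq_bigr => i _; rewrite mxE; ring.
Qed.

(** The gap is the sum of [psi a - psi t - g t * (a - t)]; the tangent at [a] bounds each
term by [(g a - g t) * (a - t)]. *)
Lemma Ft_obj_gap x u (t : 'I_p -> R) (K : R) : unit_sphere x ->
  (forall i, g (t i) = - u i 0) ->
  (forall i, `|g (t i) - g (a x i)| <= K * `|t i - a x i|) ->
  (Ft x u <= F x + (K * \sum_i (a x i - t i) ^+ 2)%:E)%E.
Proof.
move=> xM gt Lip; rewrite (Ft_objE xM gt) F_objE// -EFinD lee_fin f_objE.
rewrite -sumrN mulr_sumr -big_split/=; apply: ler_sum => i _.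
have := g_tangent (a x i) (t i); rewrite -[u i 0]opprK -gt.
have : (g (a x i) - g (t i)) * (a x i - t i) <= K * (a x i - t i) ^+ 2.
  rewrite -real_normK ?num_real// (le_trans (ler_norm _))// normrM expr2 mulrA.
  by rewrite ler_wpM2r// distrC (distrC (a x i)).
lra.
Qed.

Lemma abs_lipschitz : exists2 B : R, 0 < B &
  forall x x' i, `|a x' i - a x i| <= B * enorm (x' - x).
Proof.
have [B B0 HB] := enorm_mulmx_bound Y^T; exists B => // x x' i.
rewrite (le_trans (ler_dist_dist _ _))//.
have -> : (Y^T *m x') i 0 - (Y^T *m x) i 0 = (Y^T *m (x' - x)) i 0.
  by rewrite mulmxBr !mxE.
apply: (le_trans (coord_le_enorm _ _)); apply: HB; first exact: enorm_ge0.
by move=> j; exact: coord_le_enorm.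
Qed.

(** Only the [i]-th multiplier is moved, from [- g (t i)] to [- g t'] with [t'] on either
side of [t i].  Since the slope [g t'] is attained at [t'], the conjugate is explicit at
both multipliers, and letting [t'] tend to [t i] from the left and from the right
bounds [eta i 0] from above and from below. *)
Lemma regular_subdiff_Ft_u x u (t : 'I_p -> R) xi eta : unit_sphere x ->
  (forall i, g (t i) = - u i 0) ->
  regular_subdiff Ftz (col_mx x u) (col_mx xi eta) ->
  forall i, eta i 0 = a x i - t i.
Proof.
move=> xM gt; have E := Ft_objE xM gt; set r := \sum_i _ in E.
have Ez : Ftz (col_mx x u) = r%:E by rewrite /on_col_mx col_mxKu col_mxKd.
move=> /(regular_subdiffP _ Ez) H i.
(* The subgradient inequality along the i-th multiplier, common terms cancelled. *)
have key (eps : R) : 0 < eps -> exists2 d, 0 < d & forall t' tau,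
    tau = g (t i) - g t' -> `|tau| < d -> eta i 0 * tau - eps * `|tau| <= tau * (a x i - t').
  move=> e0; have [d d0 dH] := H _ e0; exists d => // t' tau tauE td.
  pose u' := u + tau *: delta_mx i 0.
  pose T j := if j == i then t' else t j.
  have gT j : g (T j) = - u' j 0.
    rewrite /T /u' !mxE eqxx andbT; case: (eqVneq j i) => [->|_].
      by rewrite mulr1 -[u i 0]opprK -gt tauE; ring.
    by rewrite mulr0 addr0 gt.
  have Dz : col_mx x u' - col_mx x u = col_mx 0 (tau *: delta_mx i 0).
    by rewrite opp_col_mx add_col_mx subrr /u' addrAC subrr add0r.
  have := dH (col_mx x u'); rewrite Dz enorm_col_0mx enorm_delta => /(_ td).
  rewrite /on_col_mx col_mxKu col_mxKd (Ft_objE xM gT) lee_fin dotv_col_mx.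
  have -> : dotv xi 0 = 0 by rewrite /dotv big1// => j _; rewrite mxE mulr0.
  have -> : dotv eta (tau *: delta_mx i 0) = eta i 0 * tau.
    rewrite /dotv (bigD1 i)//= big1 => [|j ji]; rewrite !mxE ?eqxx ?mulr1 ?addr0//.
    by rewrite (negPf ji) !mulr0.
  rewrite /r (bigD1 i)//= [in X in _ <= X](bigD1 i)//= add0r.
  under [X in _ <= _ + X]eq_bigr => j ji.
    rewrite /T (negPf ji) /u' !mxE (negPf ji) mulr0 addr0; over.
  rewrite /T eqxx {1}/u' !mxE !eqxx mulr1.
  have := g_tangent (t i) t'; set S := \sum_(_ < _ | _) _.
  by rewrite -[u i 0]opprK -gt tauE => ? ?; lra.
apply/le_anti/andP; split; rewrite leNgt; apply/negP => lt.
- pose e := eta i 0 - (a x i - t i); have e0 : 0 < e by rewrite /e; lra.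
  have [d d0 dH] := key (e / 2) (divr_gt0 e0 (ltr0n _ 2)).
  have : \forall t' \near (t i)^'-, [/\ t' < t i, t i - e / 4 < t' & `|g (t i) - g t'| < d].
    near=> t'; split; first by near: t'; exact: nbhs_left_lt.
      by near: t'; apply: nbhs_left_gt; rewrite ltrBlDr ltrDl divr_gt0.
    near: t'; have /cvgrPdist_lt := cvg_at_left_filter (@g_cont (t i)); exact.
  move=> /filter_ex[t' [t1 t2 /(dH _ _ erefl)]]; have := g_incr t1; rewrite -subr_gt0 => T0.
  rewrite (gtr0_norm T0) -mulrBl mulrC ler_pM2l//.
  by rewrite leNgt => /negP; apply; rewrite /e in t2 *; lra.
- pose e := (a x i - t i) - eta i 0; have e0 : 0 < e by rewrite /e; lra.
  have [d d0 dH] := key (e / 2) (divr_gt0 e0 (ltr0n _ 2)).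
  have : \forall t' \near (t i)^'+, [/\ t i < t', t' < t i + e / 4 & `|g (t i) - g t'| < d].
    near=> t'; split; first by near: t'; exact: nbhs_right_gt.
      by near: t'; apply: nbhs_right_lt; rewrite ltrDl divr_gt0.
    near: t'; have /cvgrPdist_lt := cvg_at_right_filter (@g_cont (t i)); exact.
  move=> /filter_ex[t' [t1 t2 /(dH _ _ erefl)]]; have := g_incr t1; rewrite -subr_lt0 => T0.
  have -> : eta i 0 * (g (t i) - g t') - e / 2 * `|g (t i) - g t'| =
            (g (t i) - g t') * (eta i 0 + e / 2) by rewrite ltr0_norm//; ring.
  rewrite ler_nM2l//.
  by rewrite leNgt => /negP; apply; rewrite /e in t2 *; lra.
Unshelve. all: by end_near. Qed.

(** The first-order change [<w, |y'| - |y|>] of [F], with [w_i = - g |y_i|], is split as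
[rho * <u, |y'| - |y|>], minorised by [rho *: xi], plus
[<w - rho u, |y'| - |y|>], minorised through [|y'_i| >= sgr y_i * y'_i] because its
coefficients are nonnegative. *)
Lemma regular_subdiff_project x u (t : 'I_p -> R) xi eta (rho : R) :
  unit_sphere x -> (forall i, g (t i) = - u i 0) -> 0 <= rho ->
  (forall i, 0 <= - g (a x i) - rho * u i 0) ->
  regular_subdiff Ftz (col_mx x u) (col_mx xi eta) ->
  regular_subdiff F x (rho *: xi +
    Y *m \col_i ((- g (a x i) - rho * u i 0) * Num.sg ((Y^T *m x) i 0))).
Proof.
move=> xM gt rho0 w0; have E := Ft_objE xM gt; set r := \sum_i _ in E.
have Ez : Ftz (col_mx x u) = r%:E by rewrite /on_col_mx col_mxKu col_mxKd.
move=> /(regular_subdiffP _ Ez) H; set b := \col_i _.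
apply/(regular_subdiffP _ (F_objE xM)) => eps eps0.
have [B B0 HB] := abs_lipschitz.
pose e1 := eps / 2 / (rho + 1); have e10 : 0 < e1 by rewrite !divr_gt0//; lra.
pose e2 := eps / 2 / (B * p.+1%:R).
have e20 : 0 < e2 by rewrite !divr_gt0// mulr_gt0.
have [d1 d10 d1H] := H _ e10.
have /nbhs_enormP[d2 d20 d2H] : \forall x' \near x,
    forall i, `|g (a x' i) - g (a x i)| <= e2.
  apply: (@filter_forall _ _ (fun i x' => `|g (a x' i) - g (a x i)| <= e2) (nbhs x)) => i.
  apply/nbhs_enormP.
  have /cvgrPdist_le/(_ _ e20)/nbhs_normP[d /= d0 dH] := @g_cont (a x i).
  exists (d / B); first exact: divr_gt0.
  move=> x' x'd; rewrite distrC; apply: dH; rewrite /= distrC.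
  apply: le_lt_trans (HB _ _ _) _; by rewrite mulrC -ltr_pdivlMr.
exists (Num.min d1 d2); first by rewrite lt_min d10.
move=> x'; rewrite lt_min => /andP[x'd1 x'd2].
have [x'M|x'M] := pselect (unit_sphere x'); last by rewrite F_obj_out// leey.
have := d1H (col_mx x' u).
have -> : col_mx x' u - col_mx x u = col_mx (x' - x) 0.
  by rewrite opp_col_mx add_col_mx subrr.
rewrite enorm_col_mx0 => /(_ x'd1).
rewrite /on_col_mx col_mxKu col_mxKd (Ft_objE x'M gt) dotv_col_mx !F_objE// !lee_fin.
have -> : dotv eta 0 = 0 by rewrite /dotv big1// => j _; rewrite mxE mulr0.
rewrite addr0 dotvDl dotvZl dotv_mulmxl.
set Nd := enorm _; set xd := dotv xi _; set D := _ - x in Nd xd *.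
have Nd0 : 0 <= Nd by exact: enorm_ge0.
move=> Hu.
have {Hu} Hu : xd - e1 * Nd <= \sum_i u i 0 * (a x' i - a x i).
  have -> : \sum_i u i 0 * (a x' i - a x i) =
      (\sum_i (g (t i) * t i - psi phi l (t i) + u i 0 * a x' i)) - r.
    by rewrite /r -sumrB; apply: eq_bigr => i _; ring.
  lra.
have Hphi : \sum_i (- g (a x i) * (a x' i - a x i)) - eps / 2 * Nd
    <= f_obj phi Y x' - f_obj phi Y x.
  have pe : p%:R * (e2 * (B * Nd)) <= eps / 2 * Nd.
    have -> : p%:R * (e2 * (B * Nd)) = eps / 2 * (p%:R / p.+1%:R) * Nd.
      by rewrite /e2; field; rewrite (gt_eqF B0) andbT nat1r pnatr_eq0.
    have q1 : p%:R / p.+1%:R <= 1 :> R by rewrite ler_pdivrMr// mul1r ler_nat.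
    by rewrite ler_wpM2r// ler_piMr// divr_ge0// ltW.
  rewrite lerBlDr; apply: le_trans (lerD (lexx _) pe).
  have -> : p%:R * (e2 * (B * Nd)) = \sum_(i < p) (e2 * (B * Nd)).
    by rewrite sumr_const card_ord mulr_natl.
  rewrite !f_objE opprK -!sumrN -!big_split/=; apply: ler_sum => i _.
  have := g_tangent (a x' i) (a x i).
  have : (g (a x' i) - g (a x i)) * (a x' i - a x i) <= e2 * (B * Nd).
    rewrite (le_trans (ler_norm _))// normrM ler_pM//; first exact: d2H.
  lra.
have Hsg : dotv b (Y^T *m D) + rho * \sum_i u i 0 * (a x' i - a x i) <=
    \sum_i (- g (a x i) * (a x' i - a x i)).
  rewrite /dotv mulr_sumr -big_split/=; apply: ler_sum => i _.
  rewrite /b mxE.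
  have -> : (Y^T *m D) i 0 = (Y^T *m x') i 0 - (Y^T *m x) i 0.
    by rewrite /D mulmxBr !mxE.
  rewrite -mulrA mulrBr.
  have -> : Num.sg ((Y^T *m x) i 0) * (Y^T *m x) i 0 = a x i.
    by rewrite /a normrEsg.
  have sa : Num.sg ((Y^T *m x) i 0) * (Y^T *m x') i 0 <= a x' i.
    rewrite (le_trans (ler_norm _))// normrM normr_sg ler_piMl//.
    by case: (_ != 0).
  have := ler_wpM2l (w0 i) (lerB sa (lexx (a x i))); lra.
have : rho * (xd - e1 * Nd) <= rho * \sum_i u i 0 * (a x' i - a x i).
  by rewrite ler_wpM2l.
have : rho * (e1 * Nd) <= eps / 2 * Nd.
  have r1 : rho / (rho + 1) <= 1 by rewrite ler_pdivrMr; lra.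
  have -> : rho * (e1 * Nd) = eps / 2 * (rho / (rho + 1)) * Nd by rewrite /e1; ring.
  by rewrite ler_wpM2r// ler_piMr// divr_ge0// ltW.
lra.
Qed.

End Lift.

(** * The KL inequality between real numbers *)

Section KLReal.
Context {R : realType} {m : nat}.
Implicit Types (h : 'cV[R]_m -> \bar R) (x v : 'cV[R]_m).

Lemma derive1_desing (a0 alpha nu : R) : 0 < nu ->
  derive1 (fun t : R => a0 * t `^ (1 - alpha)) nu = a0 * (1 - alpha) / nu `^ alpha.
Proof.
move=> nu0; rewrite derive1E.
have D := is_deriveZ a0 (is_derive1_powR (1 - alpha) nu0).
have -> : (fun t : R => a0 * t `^ (1 - alpha)) = a0 \*: (fun t : R => t `^ (1 - alpha)).
  by [].
rewrite derive_val (_ : 1 - alpha - 1 = - alpha); last ring.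
by rewrite powRN /GRing.scale/= mulrA.
Qed.

Lemma KL_exponent_real h x0 (r0 alpha : R) : h x0 = r0%:E ->
  KL_exponent h x0 alpha -> exists (a c : R) (V : set 'cV[R]_m),
  [/\ 0 < a, 0 < c, nbhs x0 V & forall x s v, V x -> h x = s%:E ->
    r0 < s < r0 + a -> limiting_subdiff h x v -> (s - r0) `^ alpha <= c * enorm v].
Proof.
move=> hr0 [/andP[al0 al1] _ [ae [a0 [V [ae0 a00 nV H]]]]].
have [a apos aae] : exists2 a : R, 0 < a & (a%:E <= ae)%E.
  move: ae0; case: ae {H} => [r r0'| _ |//]; first by exists r.
  by exists 1 => //; rewrite leey.
exists a, (a0 * (1 - alpha)), V; split=> //; first by rewrite mulr_gt0// subr_gt0.
move=> x s v Vx hx /andP[s0 s1] xv.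
have nu0 : 0 < s - r0 by rewrite subr_gt0.
have c0 : 0 < a0 * (1 - alpha) by rewrite mulr_gt0// subr_gt0.
have := H x Vx; rewrite hx hr0 lte_fin => /(_ s0).
have -> : (s%:E < r0%:E + ae)%E.
  by apply: (@lt_le_trans _ _ (r0 + a)%:E); rewrite ?lte_fin// EFinD leeD2l.
move=> /(_ isT) /=; rewrite derive1_desing// => Hd.
have q0 : 0 < a0 * (1 - alpha) / (s - r0) `^ alpha by rewrite divr_gt0// powR_gt0.
have : (1 <= (a0 * (1 - alpha) / (s - r0) `^ alpha)%:E * (enorm v)%:E)%E.
  by apply: (le_trans Hd); rewrite lee_pmul2l// ?lte_fin//; exact: dist0_le.
by rewrite -EFinM lee_fin mulrAC ler_pdivlMr ?powR_gt0// mul1r.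
Qed.

(** The sequence defining a limiting subgradient also has convergent values, so the
inequality holds along it and passes to the limit.  The interior of [V] is taken as the
neighbourhood so that the sequence enters [V]. *)
Lemma KL_exponent_of_regular h x0 (r0 alpha a c : R) (V : set 'cV[R]_m) :
  h x0 = r0%:E -> 0 <= alpha < 1 -> dom_subdiff h x0 -> 0 < a -> 0 < c ->
  nbhs x0 V ->
  (forall x s v, V x -> h x = s%:E -> r0 < s < r0 + a -> regular_subdiff h x v ->
    (s - r0) `^ alpha <= c * enorm v) ->
  KL_exponent h x0 alpha.
Proof.
move=> hr0 al dom a0 c0 nV H; split => //.
have al1 : 0 < 1 - alpha by rewrite subr_gt0; case/andP: al.
exists a%:E, (c / (1 - alpha)), V°.
split; [by rewrite lte_fin|exact: divr_gt0|exact: nbhs_interior|].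
move=> x Vx; rewrite hr0; case hx : (h x) => [s| |];
  [ |by move=> _; rewrite ltNge leey|by rewrite ltNge leNye].
rewrite -EFinD !lte_fin => s0 s1 /=.
have nu0 : 0 < s - r0 by rewrite subr_gt0.
rewrite derive1_desing// divfK ?gt_eqF//.
have P0 : 0 < (s - r0) `^ alpha by exact: powR_gt0.
have lb : (((s - r0) `^ alpha / c)%:E <= dist0 (limiting_subdiff h x))%E.
  apply: le_ereal_inf_tmp => _ [v [_ [xk [vk [xkx hxk reg vkv]]]] <-].
  rewrite lee_fin ler_pdivrMr// mulrC.
  move: hxk; rewrite hx => hxk.
  have fk : fine (h (xk k)) @[k --> \oo] --> s by exact: fine_cvg.
  have cvl : (fine (h (xk k)) - r0) `^ alpha @[k --> \oo] --> (s - r0) `^ alpha.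
    apply: (@cvg_comp _ _ _ (fun k => fine (h (xk k)) - r0) (fun t => t `^ alpha)
      _ (nbhs (s - r0))); first by apply: cvgB; [exact: fk|exact: cvg_cst].
    have : derivable (fun t : R => t `^ alpha) (s - r0) 1.
      by apply: derivable_powR; rewrite in_itv/= nu0.
    by move=> /derivable1_diffP/differentiable_continuous.
  have cvr : c * enorm (vk k) @[k --> \oo] --> c * enorm v.
    by apply: cvgM; [exact: cvg_cst|exact: cvg_enorm].
  apply: (ler_cvg_to cvl cvr).
  have h1 : \forall k \near \oo, r0 < fine (h (xk k)) by exact: (cvgr_gt _ fk _ s0).
  have h2 : \forall k \near \oo, fine (h (xk k)) < r0 + a by exact: (cvgr_lt _ fk _ s1).
  have h3 : \forall k \near \oo, h (xk k) \is a fin_num by exact: cvg_is_fine hxk.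
  have h4 : \forall k \near \oo, V (xk k) by exact: xkx.
  near=> k; apply: (H (xk k)) => //; first by near: k.
    by rewrite fineK//; near: k.
  by apply/andP; split; near: k.
apply: (@le_trans _ _ ((c / (s - r0) `^ alpha)%:E * ((s - r0) `^ alpha / c)%:E)%E).
  by rewrite -EFinM lee_fin mulrA divfK ?gt_eqF// divff ?gt_eqF.
by rewrite lee_pmul2l// lte_fin divr_gt0.
Unshelve. all: by end_near. Qed.

End KLReal.

(** * Transfer of the KL inequality to the lifted function *)

Section LiftedKL.
Context {R : realType} {n p : nat} (Y : 'M[R]_(n, p)) (phi : R -> R) (l : R).
Variable g : R -> R.
Hypothesis g_tangent : forall s t, psi phi l s + g s * (t - s) <= psi phi l t.
Hypothesis g_incr : forall s t, s < t -> g s < g t.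
Hypothesis g_cont : continuous g.
Hypothesis g_local : forall s0, 0 <= s0 -> \forall K \near +oo, forall a u : R,
  `|a - s0| < K^-1 -> `|u + g s0| < K^-1 ->
  [/\ K^-1 <= u, u <= K & exists2 t, g t = - u & `|g t - g a| <= K * `|t - a|].

Local Notation F := (F_obj phi Y).
Local Notation Ft := (Ft_obj phi l Y).
Local Notation Ftz := (on_col_mx (Ft_obj phi l Y)).
Implicit Types (x xi : 'cV[R]_n) (u eta : 'cV[R]_p).

Definition argmin_Ft x : 'cV[R]_p := \col_i - g `|(Y^T *m x) i 0|.

(** The scaling factor [1 - K^2 * N], with [N] the norm of the subgradient, makes the
coefficients of [regular_subdiff_project] nonnegative: [w_i - u_i] is at least [- K * N],
and the lower bound [u_i >= K^-1] turns [K^2 * N * u_i] into at least [K * N]. *)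
Lemma regular_lift_estimate xb : exists c d : R, [/\ 0 < c, 0 < d &
  forall x u xi eta, enorm (x - xb) < d -> enorm (u - argmin_Ft xb) < d ->
    enorm (col_mx xi eta) < d ->
    regular_subdiff Ftz (col_mx x u) (col_mx xi eta) ->
    (Ft x u <= F x + (c * enorm (col_mx xi eta) ^+ 2)%:E)%E /\
    exists2 v, regular_subdiff F x v & enorm v <= c * enorm (col_mx xi eta)].
Proof.
have [B B0 HB] := abs_lipschitz Y.
have [C C0 HC] := enorm_mulmx_bound Y.
pose near_slope i (K : R) := forall a u : R,
  `|a - `|(Y^T *m xb) i 0| | < K^-1 -> `|u + g `|(Y^T *m xb) i 0| | < K^-1 ->
  [/\ K^-1 <= u, u <= K & exists2 t, g t = - u & `|g t - g a| <= K * `|t - a|].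
have nearK : \forall K \near +oo, forall i, near_slope i K.
  by apply: (@filter_forall _ _ near_slope) => i; apply: g_local.
have /filter_ex[K [K1 HK]] : \forall K \near +oo, 1 < K /\ forall i, near_slope i K.
  by apply: filterI => //; apply: nbhs_pinfty_gt; exact: num_real.
have K0 : 0 < K by lra.
have iK0 : 0 < K^-1 by rewrite invr_gt0.
pose c := n%:R * (1 + C * (K + K ^+ 3)) + K.
pose d := Num.min K^-1 (Num.min (K^-1 / B) (K^-1 ^+ 2)).
have Kc : K <= c.
  by rewrite /c lerDr mulr_ge0// addr_ge0// mulr_ge0 ?addr_ge0 ?exprn_ge0 ?ltW.
have c0 : 0 < c by exact: lt_le_trans Kc.
exists c, d; split=> //.
  by rewrite !lt_min iK0 divr_gt0// exprn_gt0.
move=> x u xi eta; rewrite !lt_min => /and3P[_ xd _] /and3P[ud _ _] /and3P[_ _ zd] reg.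
set N := enorm (col_mx xi eta) in zd *.
have N0 : 0 <= N by exact: enorm_ge0.
have xM : unit_sphere x.
  by case: reg => /= dm _; apply: (@unit_sphere_dom _ _ _ Y phi l x u);
    move: dm; rewrite /edom/= /on_col_mx col_mxKu col_mxKd.
have loc i := HK i `|(Y^T *m x) i 0| (u i 0).
have {}loc i : [/\ K^-1 <= u i 0, u i 0 <= K & exists2 t, g t = - u i 0 &
    `|g t - g `|(Y^T *m x) i 0| | <= K * `|t - `|(Y^T *m x) i 0| |].
  apply: loc.
    by apply: le_lt_trans (HB _ _ _) _; rewrite mulrC -ltr_pdivlMr.
  apply: le_lt_trans ud; have := coord_le_enorm (u - argmin_Ft xb) i.
  by rewrite !mxE opprK.
have [t tP] : {t : 'I_p -> R & forall i, g (t i) = - u i 0 /\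
    `|g (t i) - g `|(Y^T *m x) i 0| | <= K * `|t i - `|(Y^T *m x) i 0| |}.
  apply: (@choice _ _ (fun i t => g t = - u i 0 /\
    `|g t - g `|(Y^T *m x) i 0| | <= K * `|t - `|(Y^T *m x) i 0| |)) => i.
  by have [_ _ [t ? ?]] := loc i; exists t.
have gt i : g (t i) = - u i 0 by case: (tP i).
have etaE := regular_subdiff_Ft_u g_tangent g_incr g_cont xM gt reg.
have etaN : enorm eta <= N by exact: enorm_col_mxr.
have xiN : enorm xi <= N by exact: enorm_col_mxl.
split.
  have [_ Lip] := all_and2 tP.
  apply: le_trans (Ft_obj_gap g_tangent xM gt Lip) _; rewrite leeD2l// lee_fin.
  have -> : \sum_i (`|(Y^T *m x) i 0| - t i) ^+ 2 = enorm eta ^+ 2.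
    by rewrite sqr_enorm; apply: eq_bigr => i _; rewrite etaE.
  apply: ler_pM; [exact: ltW|exact: sqr_ge0|exact: Kc|].
  by rewrite ler_pXn2r// nnegrE enorm_ge0.
pose sg := K ^+ 2 * N.
have sg01 : 0 <= sg <= 1.
  rewrite /sg mulr_ge0 ?sqr_ge0//= mulrC -ler_pdivlMr ?exprn_gt0// mul1r -exprVn.
  exact: ltW.
have wu i : `|- g `|(Y^T *m x) i 0| - u i 0| <= K * N.
  have [gti Lip] := tP i.
  have -> : - g `|(Y^T *m x) i 0| - u i 0 = g (t i) - g `|(Y^T *m x) i 0|.
    by rewrite gti addrC.
  apply: (le_trans Lip); apply: ler_wpM2l; first exact: ltW.
  rewrite distrC -etaE.
  exact: le_trans (coord_le_enorm _ _) etaN.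
have rho0 : 0 <= 1 - sg by lra.
have w0 i : 0 <= - g `|(Y^T *m x) i 0| - (1 - sg) * u i 0.
  have [u1 _ _] := loc i; have := wu i; rewrite ler_norml => /andP[lo _].
  have : K * N <= sg * u i 0.
    have -> : K * N = sg * K^-1 by rewrite /sg; field; rewrite gt_eqF.
    by rewrite ler_wpM2l//; case/andP: sg01.
  lra.
eexists; first exact: (regular_subdiff_project g_tangent g_cont xM gt rho0 w0 reg).
set b := \col_i _.
have bN i : `|b i 0| <= (K + K ^+ 3) * N.
  rewrite mxE normrM normr_sg.
  apply: (@le_trans _ _ `|- g `|(Y^T *m x) i 0| - (1 - sg) * u i 0|).
    by rewrite ler_piMr//; case: (_ != 0).
  have -> : - g `|(Y^T *m x) i 0| - (1 - sg) * u i 0 =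
     (- g `|(Y^T *m x) i 0| - u i 0) + sg * u i 0 by ring.
  apply: (le_trans (ler_normD _ _)); rewrite mulrDl lerD//.
  have [u1 u2 _] := loc i.
  have u0 : 0 <= u i 0 by lra.
  have sg0 : 0 <= sg by lra.
  rewrite (ger0_norm (mulr_ge0 sg0 u0)).
  have -> : K ^+ 3 * N = sg * K by rewrite /sg; ring.
  by rewrite ler_wpM2l.
have KN0 : 0 <= (K + K ^+ 3) * N by rewrite mulr_ge0// addr_ge0 ?exprn_ge0 ?ltW.
have Yb := HC b _ KN0 bN.
apply: (@le_trans _ _ (n%:R * (enorm xi + enorm (Y *m b)))).
  by apply: enormZD; lra.
apply: (@le_trans _ _ (n%:R * ((1 + C * (K + K ^+ 3)) * N))).
  by rewrite ler_wpM2l//; lra.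
by rewrite mulrA ler_wpM2r// /c; lra.
Qed.

(** As [F] is a minorant of [Ft] with equality at [argmin_Ft x], a regular subgradient
[v] of [F] at [x] yields the regular subgradient [(v, 0)] of [Ft]; continuity of [g]
carries this along the approximating sequence. *)
Lemma dom_subdiff_lift xb : unit_sphere xb ->
  dom_subdiff F xb -> dom_subdiff Ftz (col_mx xb (argmin_Ft xb)).
Proof.
move=> xbM [v [domF [xk [vk [xkx Fxk reg vkv]]]]].
have xkM k : unit_sphere (xk k).
  have [/= dm _] := reg k; apply: contrapT => nM.
  by move: dm; rewrite /edom/= F_obj_out.
have FtE x : unit_sphere x -> Ftz (col_mx x (argmin_Ft x)) = F x.
  by move=> xM; rewrite /on_col_mx col_mxKu col_mxKd Ft_obj_argmin.
exists (col_mx v 0); split; first by rewrite /edom/= FtE.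
exists (fun k => col_mx (xk k) (argmin_Ft (xk k))), (fun k => col_mx (vk k) 0); split.
- apply: cvg_col => i; case: (split_ordP i) => j ->.
    under eq_fun do rewrite col_mxEu; rewrite col_mxEu; exact: cvg_coord.
  under eq_fun do rewrite col_mxEd mxE; rewrite col_mxEd mxE; apply: cvgN.
  apply: (@cvg_comp _ _ _ (fun k => `|(Y^T *m xk k) j 0|) g _
    (nbhs `|(Y^T *m xb) j 0|)); last exact: g_cont.
  apply/cvgrPdist_lt => e e0; have [B B0 HB] := abs_lipschitz Y.
  have eB : 0 < e / B by exact: divr_gt0.
  apply: filterS (cvg_enorm_sub eB xkx) => k xke; rewrite distrC.
  by apply: le_lt_trans (HB _ _ _) _; rewrite mulrC -ltr_pdivlMr.
- by under eq_fun do rewrite FtE//; rewrite FtE.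
- move=> k; apply/(regular_subdiffP _ (etrans (FtE _ (xkM k)) (F_objE Y phi (xkM k)))).
  move=> e e0; have /(regular_subdiffP _ (F_objE Y phi (xkM k)))/(_ _ e0)[d d0 dH] := reg k.
  exists d => // z; rewrite -(vsubmxK z) opp_col_mx add_col_mx => zd.
  rewrite dotv_col_mx {2}/dotv big1 ?addr0; last by move=> i _; rewrite mxE mul0r.
  have xd := enorm_col_mxl (usubmx z - xk k) (dsubmx z - argmin_Ft (xk k)).
  rewrite /on_col_mx col_mxKu col_mxKd; apply: le_trans (F_le_Ft Y phi l _ _).
  apply: le_trans (dH _ (le_lt_trans xd zd)); rewrite lee_fin lerD2l lerN2.
  by rewrite ler_wpM2l// ltW.
- apply: cvg_col => i; case: (split_ordP i) => j ->.
    under eq_fun do rewrite col_mxEu; rewrite col_mxEu; exact: cvg_coord.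
  under eq_fun do rewrite col_mxEd mxE; rewrite col_mxEd mxE; exact: cvg_cst.
Qed.

(** The step where the exponent has to be at least one half: a quadratic bound on [nu]
becomes a linear bound on [nu `^ alpha]. *)
Lemma powR_half_le (alpha nu N c : R) : 2^-1 <= alpha -> 0 < nu -> nu <= 1 -> 0 <= N ->
  0 < c -> nu <= c * N ^+ 2 -> nu `^ alpha <= (c + 1) * N.
Proof.
move=> al nu0 nu1 N0 c0 H.
apply: (@le_trans _ _ (nu `^ 2^-1)).
  apply: ger_powR => //; by rewrite nu0.
rewrite (powR12_sqrt (ltW nu0)).
have cN0 : 0 <= (c + 1) * N by rewrite mulr_ge0// ltW// addr_gt0.
rewrite -(@ler_pXn2r _ 2)// ?nnegrE ?sqrtr_ge0// (sqr_sqrtr (ltW nu0)) exprMn.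
by apply: (le_trans H); rewrite ler_wpM2r ?sqr_ge0//; nra.
Qed.

(** Subgradients that are not small satisfy the inequality trivially as [nu <= 1]; for small
ones, [nu] is dominated either by the gap [Ft x u - F x] or by [F x - F xb]. *)
Lemma KL_exponent_lift xb (alpha : R) : unit_sphere xb -> 2^-1 <= alpha < 1 ->
  KL_exponent F xb alpha -> KL_exponent Ftz (col_mx xb (argmin_Ft xb)) alpha.
Proof.
move=> xbM /andP[al2 al1] KL.
have al0 : 0 <= alpha by apply: le_trans al2; rewrite invr_ge0.
have Fxb := F_objE Y phi xbM; set fb := f_obj phi Y xb in Fxb.
have [_ domF _] := KL.
have [a [c1 [V [a0 c10 nV HF]]]] := KL_exponent_real Fxb KL.
have [c2 [d [c20 d0 Hreg]]] := regular_lift_estimate xb.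
have /nbhs_enormP[d1 d10 d1V] := nV.
pose d2 := Num.min d d1; have d20 : 0 < d2 by rewrite lt_min d0.
pose a' := Num.min a 1; have a'0 : 0 < a' by rewrite lt_min a0 ltr01.
pose c := 2 * (c1 * c2) + (2 * c2 + 1) + d^-1.
have c12 : 0 < c1 * c2 by rewrite mulr_gt0.
have id0 : 0 < d^-1 by rewrite invr_gt0.
have c0 : 0 < c by rewrite /c; lra.
apply: (@KL_exponent_of_regular _ _ _ _ fb alpha a' c
  [set z | enorm (z - col_mx xb (argmin_Ft xb)) < d2]) => //.
- by rewrite /on_col_mx col_mxKu col_mxKd Ft_obj_argmin.
- by rewrite al0.
- exact: dom_subdiff_lift.
- by apply/nbhs_enormP; exists d2.
move=> z s v; rewrite -(vsubmxK z) -(vsubmxK v) /= opp_col_mx add_col_mx.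
set x := usubmx z; set u := dsubmx z; set xi := usubmx v; set eta := dsubmx v.
move=> zd; rewrite {1}/on_col_mx col_mxKu col_mxKd => Fts /andP[s0 s1] reg.
have xd : enorm (x - xb) < d2 by apply: le_lt_trans zd; exact: enorm_col_mxl.
have ud : enorm (u - argmin_Ft xb) < d2 by apply: le_lt_trans zd; exact: enorm_col_mxr.
move: xd ud s1; rewrite !lt_min => /andP[xd xd1] /andP[ud ud1].
rewrite -ltrBlDl lt_min => /andP[sa s1].
set N := enorm _; have N0 : 0 <= N by exact: enorm_ge0.
have nu0 : 0 < s - fb by lra.
have [Nd|Nd] := ltP N d; last first.
  apply: (@le_trans _ _ 1).
    have p1 : 1 `^ alpha = 1 :> R by rewrite powR1.
    rewrite -[leRHS]p1; apply: ge0_ler_powR; rewrite ?nnegrE//; exact: ltW.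
  apply: (@le_trans _ _ (d^-1 * N)); first by rewrite mulrC ler_pdivlMr// mul1r.
  by rewrite ler_wpM2r// /c; lra.
have [gap [w regw wN]] := Hreg _ _ _ _ xd ud Nd reg.
have xM : unit_sphere x by apply: (@unit_sphere_dom _ _ _ Y phi l x u); rewrite Fts ltry.
have Fx := F_objE Y phi xM; set fx := f_obj phi Y x in Fx.
move: gap; rewrite Fts Fx -EFinD lee_fin -/N => gap.
have fxs : fx <= s by rewrite -lee_fin -Fx -Fts; exact: F_le_Ft.
have [half|half] := leP (s - fb) (2 * (c2 * N ^+ 2)).
  apply: (@le_trans _ _ ((2 * c2 + 1) * N)).
    by apply: powR_half_le => //; rewrite -?mulrA//; lra.
  by rewrite ler_wpM2r// /c; lra.
have nu1 : s - fb <= 2 * (fx - fb) by lra.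
have nu2 : 0 < fx - fb by lra.
have fxr : fb < fx < fb + a by apply/andP; split; lra.
have := HF x fx w (d1V _ xd1) Fx fxr (regular_subdiff_limiting regw) => Hw.
apply: (@le_trans _ _ ((2 * (fx - fb)) `^ alpha)).
  by rewrite ge0_ler_powR ?nnegrE//; lra.
rewrite powRM//; last exact: ltW.
have p2 : 2 `^ alpha <= (2 : R).
  by apply: ler1_powR; [rewrite ler1n|exact: ltW].
apply: (@le_trans _ _ (2 * (c1 * (c2 * N)))).
  apply: ler_pM => //; rewrite ?powR_ge0//.
  by apply: (le_trans Hw); rewrite ler_wpM2l// ltW.
by rewrite !mulrA ler_wpM2r// /c -!mulrA; lra.
Qed.

End LiftedKL.

(** * The theorem *)

Unset Implicit Arguments.
Set Strict Implicit.

Theorem theorem4p10 (R : realType) (n p : nat) (Y : 'M[R]_(n, p))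
    (phi : R -> R) (l : R) (xbar : 'cV[R]_n) (alpha : R)
    (phi_ge0 : forall s : R, 0 <= s -> 0 <= phi s)
    (phi_cont : {within `[0, +oo[, continuous phi})
    (phi_concave : concave_on `[0, +oo[ phi)
    (phi0 : phi 0 = 0)
    (phi_diff : forall s : R, 0 < s -> derivable phi s 1)
    (phi_l : derive1 phi s @[s --> 0^'+] --> l)
    (phi_sconcave : strictly_concave_on `[0, +oo[ phi)
    (phi_lip : locally_lipschitz_on `[0, +oo[ (right_derivative phi))
    (xbarM : unit_sphere xbar)
    (alpha_itv : 2^-1 <= alpha < 1)
    (F_KL : KL_exponent (F_obj phi Y) xbar alpha) :
  let zbar := col_mx xbar (- grad (Psi phi l) (absv (Y^T *m xbar))) in
  dom_subdiff (on_col_mx (Ft_obj phi l Y)) zbar /\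
  KL_exponent (on_col_mx (Ft_obj phi l Y)) zbar alpha.
Proof.
move=> zbar.
have tgt := psi_tangent phi_cont phi0 phi_diff phi_l phi_sconcave.
have inc := dpsi_incr phi_cont phi0 phi_diff phi_l phi_sconcave.
have cont := dpsi_continuous phi_cont phi0 phi_diff phi_l phi_sconcave phi_lip.
have loc := dpsi_local phi_ge0 phi_cont phi0 phi_diff phi_l phi_sconcave phi_lip.
have -> : zbar = col_mx xbar (argmin_Ft Y (dpsi phi l) xbar).
  congr col_mx; apply/colP => i.
  by rewrite [LHS]mxE (grad_Psi phi_cont phi0 phi_diff phi_l phi_sconcave phi_lip) !mxE.
have KL := KL_exponent_lift tgt inc cont loc xbarM alpha_itv F_KL.
by split=> //; case: KL.
Qed.
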